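(* Let $n \geqslant 3$ be an integer, let $\mathcal{G}$ be a real vector space of dimension $n$ with basis $(X_1, X_2, \ldots, X_n)$, and let $\mathcal{G}^1 = \mathrm{Span}(X_1, \ldots, X_{n-1})$. For an invertible real $(n-1)\times(n-1)$ matrix $A=(a_{ij})$, let $[\cdot,\cdot]_A$ denote the skew-symmetric bilinear bracket on $\mathcal{G}$ determined by $$[X_n, X_j]_A = \sum_{i=1}^{n-1} a_{ij} X_i \quad (j = 1, \ldots, n-1), \qquad [X_i,X_j]_A = 0 \quad (1\leqslant i,j\leqslant n-1).$$ (i) Each invertible real $(n-1)\times(n-1)$ matrix $A$ defines, via $[\cdot,\cdot]_A$, a Lie structure on $\mathcal{G}$ such that $\mathcal{G}$ is an $MD(n,n-1)$-algebra whose first derived ideal is commutative and exactly equal to $\mathcal{G}^1$, and $A$ is exactly the matrix of the adjoint map $\mathrm{ad}_{X_n}$ on $\mathcal{G}^1$ in the basis $(X_1, \ldots, X_{n-1})$. (ii) Two invertible real $(n-1)\times(n-1)$ matrices $A, B$ define isomorphic Lie structures on $\mathcal{G}$, i.e. $(\mathcal{G},[\cdot,\cdot]_A)\cong(\mathcal{G},[\cdot,\cdot]_B)$ as Lie algebras, if and only if there exist a non-zero real number $c$ and an invertible real $(n-1)\times(n-1)$ matrix $C$ such that $cA = CBC^{-1}$.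
   Context: For a Lie group $G$ with Lie algebra $\mathcal{G}$, the coadjoint representation $K$ of $G$ in the dual space $\mathcal{G}^*$ is $\langle K_{(g)}F, X\rangle = \langle F, \mathrm{Ad}(g^{-1})X\rangle$, and its orbits are called $K$-orbits. The $K$-orbit $\Omega_F$ of $F\in\mathcal{G}^*$ has dimension equal to the rank of the skew-symmetric bilinear form $B_F(X,Y)=\langle F,[X,Y]\rangle$ on $\mathcal{G}$. An $MD$-group is a finite-dimensional real solvable Lie group (taken connected and simply connected) each of whose $K$-orbits has dimension either zero or the maximal dimension among all $K$-orbits of the group. An $MD$-algebra is the Lie algebra of an $MD$-group (equivalently, a finite-dimensional real solvable Lie algebra for which every $B_F$ has rank $0$ or rank $\max_{F'}\operatorname{rank}B_{F'}$). For $0<m<n$, an $MD(n,m)$-algebra is an $n$-dimensional $MD$-algebra whose first derived ideal $[\mathcal{G},\mathcal{G}]$ is $m$-dimensional. *)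

(* Defs.v *)
From HB Require Import structures.
From mathcomp Require Import all_boot all_order all_algebra.
From mathcomp Require Import reals.

Set Implicit Arguments.
Unset Strict Implicit.
Unset Printing Implicit Defensive.

Import Order.TTheory GRing.Theory Num.Theory.
Local Open Scope ring_scope.

Section LieAlgebra.
Variables (R : realType) (V : vectType R).
Implicit Types (br : V -> V -> V) (U W : {vspace V}).

Definition is_bilinear (W : lmodType R) (f : V -> V -> W) : Prop :=
  (forall u, linear (f u)) /\ (forall v, linear (f^~ v)).

Record is_lie_bracket br : Prop := IsLieBracket {
  lie_bilinear : is_bilinear br;
  lie_alternating : forall x, br x x = 0;
  lie_jacobi : forall x y z,
    br x (br y z) + br y (br z x) + br z (br x y) = 0 }.

(* The span of all [u, w] with u in U and w in W: for a bilinear bracket,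
   brackets of basis vectors suffice, see lie_prodP. *)
Definition lie_prod br U W : {vspace V} :=
  <<[seq br u w | u <- vbasis U, w <- vbasis W]>>%VS.

Definition derived_ideal br : {vspace V} := lie_prod br fullv fullv.

Definition lie_solvable br : Prop :=
  exists k : nat, iter k (fun U => lie_prod br U U) fullv = 0%VS.

Definition commutative_on br U : Prop := {in U &, forall u v, br u v = 0}.

(* The linear map V -> V^* induced by a bilinear form. *)
Definition form_map (B : V -> V -> R^o) : 'Hom(V, 'Hom(V, R^o)) :=
  linfun (fun x => linfun (B x)).

Definition form_rank (B : V -> V -> R^o) : nat := \dim (limg (form_map B)).

Definition coadjoint_form br (F : 'Hom(V, R^o)) : V -> V -> R^o :=
  fun x y => F (br x y).

(* The K-orbit of F has dimension form_rank (coadjoint_form br F). *)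
Record is_MD_algebra br : Prop := IsMDAlgebra {
  MD_lie : is_lie_bracket br;
  MD_solvable : lie_solvable br;
  MD_orbits : forall F : 'Hom(V, R^o),
    form_rank (coadjoint_form br F) = 0%N \/
    (forall F' : 'Hom(V, R^o),
       form_rank (coadjoint_form br F') <= form_rank (coadjoint_form br F))%N }.

Definition is_MD_algebra_nm br (n m : nat) : Prop :=
  [/\ (0 < m < n)%N, is_MD_algebra br, \dim (fullv : {vspace V}) = n &
      \dim (derived_ideal br) = m].

(* Column convention: f e_j = \sum_i A i j *: e_i. *)
Definition is_matrix_of k (f : V -> V) U (e : k.-tuple V) (A : 'M[R]_k) : Prop :=
  [/\ basis_of U e, {in U, forall u, f u \in U} &
      A = \matrix_(i, j) coord e i (f e`_j)].

Lemma lie_prodP br U W : is_bilinear br ->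
  {in U & W, forall u w, br u w \in lie_prod br U W} /\
  (forall Z : {vspace V}, {in U & W, forall u w, br u w \in Z} ->
     (lie_prod br U W <= Z)%VS).
Proof.
move=> [linr linl]; split=> [u w uU wW|Z brZ]; last first.
  apply/span_subvP=> _ /allpairsP[[u w] /= [uU wW ->]].
  by apply: brZ; apply: vbasis_mem.
pose Lr x : {linear V -> V} :=
  HB.pack (br x) (GRing.isLinear.Build _ _ _ _ _ (linr x)).
pose Ll y : {linear V -> V} :=
  HB.pack (br^~ y) (GRing.isLinear.Build _ _ _ _ _ (linl y)).
rewrite (coord_vbasis uU) -[br _ w]/(Ll w _) linear_sum memv_suml //= => i _.
rewrite -[br _ w]/(Ll w _) linearZ memvZ //= (coord_vbasis wW).
rewrite -[br _ _]/(Lr _ _) linear_sum memv_suml //= => j _.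
rewrite -[br _ _]/(Lr _ _) linearZ memvZ //=; apply: memv_span.
by apply: allpairs_f; apply: mem_nth; rewrite size_tuple.
Qed.

Lemma form_mapE (B : V -> V -> R^o) : is_bilinear B ->
  forall x y, form_map B x y = B x y.
Proof.
move=> [linr linl].
pose L x : {linear V -> R^o} :=
  HB.pack (B x) (GRing.isLinear.Build _ _ _ _ _ (linr x)).
have linM : linear (fun x => linfun (B x)).
  move=> a x x'; apply/lfunP=> y; rewrite add_lfunE scale_lfunE.
  by rewrite (lfunE (L _)) (lfunE (L x)) (lfunE (L x')) /= linl.
pose M : {linear V -> 'Hom(V, R^o)} :=
  HB.pack (fun x => linfun (B x)) (GRing.isLinear.Build _ _ _ _ _ linM).
by move=> x y; rewrite /form_map -[X in linfun X]/(M : _ -> _) lfunE /= (lfunE (L x)).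
Qed.

End LieAlgebra.

Definition lie_isomorphic (R : realType) (V W : vectType R)
    (brV : V -> V -> V) (brW : W -> W -> W) : Prop :=
  exists f : 'Hom(V, W),
    bijective f /\ forall x y, f (brV x y) = brW (f x) (f y).

Section MatrixBracket.
Variables (R : realType) (V : vectType R) (n : nat) (X : n.-tuple V).

(* Indices start at 0: X`_0, ..., X`_(n.-2) span the hyperplane, and the
   distinguished last vector is X`_n.-1. *)
Definition hyper_basis : n.-1.-tuple V := [tuple X`_i | i < n.-1].

Definition hyperplane : {vspace V} := <<hyper_basis>>%VS.

(* For i : 'I_n, [insub (val i) : option 'I_n.-1] is None exactly when i is
   the last index. *)
Definition structure_vec (A : 'M[R]_n.-1) (i j : 'I_n) : V :=
  match insub (val i) : option 'I_n.-1, insub (val j) : option 'I_n.-1 with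
  | None, Some j' => \sum_(k < n.-1) A k j' *: X`_k
  | Some i', None => - \sum_(k < n.-1) A k i' *: X`_k
  | _, _ => 0
  end.

Definition mx_bracket (A : 'M[R]_n.-1) (u v : V) : V :=
  \sum_(i < n) \sum_(j < n) (coord X i u * coord X j v) *: structure_vec A i j.

Definition mx_bracket_spec (A : 'M[R]_n.-1) (br : V -> V -> V) : Prop :=
  [/\ is_bilinear br, forall u v, br u v = - br v u,
      forall j : 'I_n.-1, br X`_n.-1 X`_j = \sum_(i < n.-1) A i j *: X`_i &
      forall i j : 'I_n.-1, br X`_i X`_j = 0].

Lemma mx_bracketP (A : 'M[R]_n.-1) : (0 < n)%N -> basis_of fullv X ->
  mx_bracket_spec A (mx_bracket A).
Proof.
move=> n_gt0 basisX; have freeX := basis_free basisX.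
have brE (i j : 'I_n) : mx_bracket A X`_i X`_j = structure_vec A i j.
  rewrite /mx_bracket (bigD1 i) //= (bigD1 j) //= !coord_free // !eqxx mulr1.
  rewrite scale1r !big1 ?addr0 // => [i' /negPf ni|j' /negPf nj].
    rewrite big1 // => j' _; rewrite coord_free // eq_sym ni mul0r scale0r //.
  by rewrite !coord_free // (eq_sym j) nj mulr0 scale0r.
have ltp (j : 'I_n.-1) : (j < n)%N by exact: leq_trans (ltn_ord j) (leq_pred n).
have ltl : (n.-1 < n)%N by rewrite prednK.
split.
- split=> [u a v w|v a u w]; rewrite /mx_bracket scaler_sumr -big_split;
    apply: eq_bigr => i _; rewrite scaler_sumr -big_split; apply: eq_bigr => j _.
    by rewrite linearP /= mulrDr scalerDl scalerA mulrCA.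
  by rewrite linearP /= mulrDl scalerDl scalerA mulrA.
- move=> u v; rewrite /mx_bracket exchange_big -sumrN; apply: eq_bigr => i _.
  rewrite -sumrN; apply: eq_bigr => j _; rewrite mulrC -scalerN; congr (_ *: _).
  by rewrite /structure_vec; case: insub => [i'|]; case: insub => [j'|];
    rewrite ?oppr0 ?opprK.
- move=> j; rewrite (brE (Ordinal ltl) (Ordinal (ltp j))) /structure_vec /=.
  by rewrite insubF ?ltnn // valK.
- move=> i j; rewrite (brE (Ordinal (ltp i)) (Ordinal (ltp j))).
  by rewrite /structure_vec /= !valK.
Qed.

Lemma mx_bracket_unique (A : 'M[R]_n.-1) (br : V -> V -> V) :
  (0 < n)%N -> basis_of fullv X ->
  mx_bracket_spec A br -> forall u v, br u v = mx_bracket A u v.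
Proof.
move=> n_gt0 basisX [[linr linl] skew brl br0] u v.
pose Lr x : {linear V -> V} :=
  HB.pack (br x) (GRing.isLinear.Build _ _ _ _ _ (linr x)).
pose Ll y : {linear V -> V} :=
  HB.pack (br^~ y) (GRing.isLinear.Build _ _ _ _ _ (linl y)).
have last (i : 'I_n) : (i < n.-1)%N = false -> val i = n.-1.
  move=> /negbT; rewrite -leqNgt => le; apply/eqP; rewrite eqn_leq le andbT.
  by rewrite -ltnS prednK ?ltn_ord.
have br_ll : br X`_n.-1 X`_n.-1 = 0.
  have /eqP := skew X`_n.-1 X`_n.-1; rewrite -subr_eq0 opprK -mulr2n.
  by rewrite -scaler_nat scaler_eq0 pnatr_eq0 /= => /eqP.
rewrite /mx_bracket [in LHS](coord_basis basisX (memvf u)).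
rewrite -[LHS]/(Ll v _) linear_sum; apply: eq_bigr => i _.
rewrite linearZ /= [in LHS](coord_basis basisX (memvf v)).
rewrite -[br _ _]/(Lr _ _) linear_sum scaler_sumr; apply: eq_bigr => j _.
rewrite linearZ /= scalerA; congr (_ *: _); rewrite /structure_vec.
case: insubP => [i' _ <-|/negbTE/last ->];
  case: insubP => [j' _ <-|/negbTE/last ->].
- exact: br0.
- by rewrite skew; congr (- _); apply: brl.
- exact: brl.
- exact: br_ll.
Qed.

End MatrixBracket.

(* Main.v *)
Require Import Defs.
From HB Require Import structures.
From mathcomp Require Import all_boot all_order all_algebra.
From mathcomp Require Import reals ring.
Import Order.TTheory GRing.Theory Num.Theory.
Local Open Scope ring_scope.

(** Write every vector of [G] as a pair (x, t), standing for the element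
    x_1 X_1 + ... + x_m X_m + t X_n with m = n - 1. In these coordinates
    [(x, s), (y, t)]_A = (A (s y - t x), 0).
    All the claims in (i) can be read off this formula; the form B_F sends
    (x, s), (y, t) to s p(y) - t p(x) with p := F o A, so it has rank 2 when
    p <> 0 and rank 0 otherwise.
    For (ii), an isomorphism f preserves the derived ideal, the hyperplane
    t = 0, where it acts by an invertible matrix P, and it multiplies t by some
    c <> 0. Compatibility with the brackets then reads P A = c B P. Conversely,
    from such P and c, the map (x, t) |-> (P x, c t) is an isomorphism. *)

Section HyperplaneCoordinates.
Context {R : realType} {V : vectType R} {m : nat} (X : m.+1.-tuple V).
Hypothesis basisX : basis_of fullv X.

(** * Coordinates (x, t) relative to the hyperplane and the last basis vector *)

Definition of_hyper (x : 'cV[R]_m) : V := \sum_(i < m) x i 0 *: X`_i.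

Definition hyper_coord (u : V) : 'cV[R]_m :=
  \col_i coord X (widen_ord (leqnSn m) i) u.

Definition last_coord (u : V) : R := coord X ord_max u.

Fact of_hyper_is_linear : linear of_hyper.
Proof.
move=> a x y; rewrite /of_hyper scaler_sumr -big_split; apply: eq_bigr => i _.
by rewrite !mxE scalerDl scalerA.
Qed.

HB.instance Definition _ :=
  GRing.isLinear.Build R 'cV[R]_m V _ of_hyper of_hyper_is_linear.

Fact hyper_coord_is_linear : linear hyper_coord.
Proof. by move=> a u v; apply/colP => i; rewrite !mxE linearP. Qed.

HB.instance Definition _ :=
  GRing.isLinear.Build R V 'cV[R]_m _ hyper_coord hyper_coord_is_linear.

Fact last_coord_is_linear : scalar last_coord.
Proof. by move=> a u v; rewrite /last_coord linearP. Qed.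

HB.instance Definition _ :=
  GRing.isLinear.Build R V R _ last_coord last_coord_is_linear.

Lemma hyper_decomp u :
  u = of_hyper (hyper_coord u) + last_coord u *: X`_m.
Proof.
rewrite {1}(coord_basis basisX (memvf u)) big_ord_recr /=; congr (_ + _).
by apply: eq_bigr => i _; rewrite mxE.
Qed.

Lemma hyper_coord_last : hyper_coord X`_m = 0.
Proof.
apply/colP => i; rewrite !mxE (coord_free (@ord_max m) _ (basis_free basisX)).
by rewrite -val_eqE /= gtn_eqF.
Qed.

Lemma last_coord_last : last_coord X`_m = 1.
Proof.
by rewrite /last_coord (coord_free (@ord_max m) _ (basis_free basisX)) eqxx.
Qed.

Lemma last_coord_of_hyper x : last_coord (of_hyper x) = 0.
Proof.
rewrite /of_hyper linear_sum big1 // => i _; rewrite linearZ /= /last_coord.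
rewrite (coord_free (widen_ord (leqnSn m) i) _ (basis_free basisX)).
by rewrite -val_eqE /= ltn_eqF ?mulr0.
Qed.

Lemma of_hyperK : cancel of_hyper hyper_coord.
Proof.
move=> x; apply/colP => i; rewrite !mxE /of_hyper linear_sum (bigD1 i) //=.
rewrite linearZ /= (coord_free (widen_ord (leqnSn m) i) _ (basis_free basisX)).
rewrite eqxx mulr1 big1 ?addr0 // => j ji; rewrite linearZ /=.
rewrite (coord_free (widen_ord (leqnSn m) j) _ (basis_free basisX)).
by rewrite -val_eqE /= val_eqE (negPf ji) mulr0.
Qed.

Lemma hyper_coordK u : last_coord u = 0 -> of_hyper (hyper_coord u) = u.
Proof. by move=> u0; rewrite [RHS]hyper_decomp u0 scale0r addr0. Qed.

Lemma of_hyper_delta (i : 'I_m) : of_hyper (delta_mx i 0) = X`_i.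
Proof.
rewrite /of_hyper (bigD1 i) //= mxE !eqxx scale1r big1 ?addr0 // => j ji.
by rewrite mxE (negPf ji) scale0r.
Qed.

Lemma mem_hyperplane u : (u \in hyperplane X) = (last_coord u == 0).
Proof.
apply/idP/eqP => [|/hyper_coordK <-].
  move=> /coord_span->; rewrite linear_sum big1 // => i _.
  by rewrite linearZ /= nth_mktuple -of_hyper_delta last_coord_of_hyper mulr0.
apply: memv_suml => i _; apply/memvZ/memv_span/mapP.
by exists i => //; rewrite mem_enum.
Qed.

(** A linear combination of the family is [of_hyper] of its column of coefficients, and [of_hyperK]
    recovers that column. *)
Lemma hyper_basis_free : free (hyper_basis X).
Proof.
apply/freeP => k k0 i; suff /colP/(_ i) : \col_j k j = 0 by rewrite !mxE.
rewrite -[LHS]of_hyperK -(linear0 hyper_coord) -[in RHS]k0; congr hyper_coord.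
by apply: eq_bigr => j _; rewrite mxE nth_mktuple.
Qed.

Lemma dim_hyperplane : \dim (hyperplane X) = m.
Proof. by rewrite (eqnP hyper_basis_free) size_tuple. Qed.

(** * The bracket in coordinates and its Lie structure *)

Lemma mx_bracketE (A : 'M[R]_m) u v :
  mx_bracket X A u v =
  of_hyper (A *m (last_coord u *: hyper_coord v - last_coord v *: hyper_coord u)).
Proof.
pose br u v :=
  of_hyper (A *m (last_coord u *: hyper_coord v - last_coord v *: hyper_coord u)).
(* The closed formula satisfies [mx_bracket_spec], which determines the bracket, so the defining
   double sum need not be expanded. *)
symmetry; apply: (@mx_bracket_unique R V m.+1 X A br) => //; split.
- split=> [w a x y|w a x y]; rewrite /br -linearP /= scalemxAr -mulmxDr;
    congr (of_hyper (_ *m _)); apply/colP => i; rewrite !linearP !mxE /=; ring.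
- by move=> x y; rewrite /br -opprB mulmxN linearN.
- move=> j; rewrite /br last_coord_last -of_hyper_delta last_coord_of_hyper.
  rewrite scale1r scale0r subr0 of_hyperK /of_hyper.
  by apply: eq_bigr => i _; rewrite -colE mxE.
move=> i j; rewrite /br -!of_hyper_delta !last_coord_of_hyper !scale0r subrr.
by rewrite mulmx0 linear0.
Qed.

Lemma last_coord_mx_bracket A u v : last_coord (mx_bracket X A u v) = 0.
Proof. by rewrite mx_bracketE last_coord_of_hyper. Qed.

Lemma mx_bracket_last A x :
  mx_bracket X A X`_m (of_hyper x) = of_hyper (A *m x).
Proof.
by rewrite mx_bracketE last_coord_last last_coord_of_hyper of_hyperK scale1r
  scale0r subr0.
Qed.

Lemma mx_bracket_lie A : is_lie_bracket (mx_bracket X A).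
Proof.
have [bil skew _ _] := @mx_bracketP R V m.+1 X A isT basisX.
split=> // [x|x y z]; first by rewrite mx_bracketE subrr mulmx0 linear0.
rewrite !(mx_bracketE A _ (mx_bracket _ _ _ _)) !last_coord_mx_bracket.
rewrite !scale0r !subr0 !mx_bracketE !of_hyperK -!(linearD of_hyper).
(* Inner brackets have last coordinate 0, so the Jacobi sum is the image of A (A w), where w is the
   cyclic sum of r (s z - t y) for the vectors (x, r), (y, s), (z, t); its terms cancel in pairs. *)
rewrite !scalemxAr -!mulmxDr; set w := (X in A *m (A *m X)).
suff -> : w = 0 by rewrite !mulmx0 linear0.
by apply/colP => i; rewrite !mxE; ring.
Qed.

Lemma mx_bracket_commutative A :
  commutative_on (mx_bracket X A) (hyperplane X).
Proof.
move=> u v; rewrite !mem_hyperplane => /eqP u0 /eqP v0.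
by rewrite mx_bracketE u0 v0 !scale0r subrr mulmx0 linear0.
Qed.

Lemma derived_ideal_mx_bracket A : A \in unitmx ->
  derived_ideal (mx_bracket X A) = hyperplane X.
Proof.
move=> uA; have [mem_prod prod_min] :=
  lie_prodP fullv fullv (lie_bilinear (mx_bracket_lie A)).
apply/eqP; rewrite eqEsubv prod_min => [|u v _ _]; last first.
  by rewrite mem_hyperplane last_coord_mx_bracket.
apply/subvP => u; rewrite mem_hyperplane => /eqP/hyper_coordK <-.
(* Invertibility of A enters here: (x, 0) is the bracket of the last basis vector with (A^-1 x,
   0). *)
by rewrite -(mulKVmx uA (hyper_coord u)) -mx_bracket_last mem_prod ?memvf.
Qed.

(** The derived series stops after two steps because the derived ideal is the commutative
    hyperplane. *)
Lemma mx_bracket_solvable A : A \in unitmx -> lie_solvable (mx_bracket X A).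
Proof.
move=> uA; exists 2; apply/eqP; rewrite -subv0 /=.
rewrite -/(derived_ideal (mx_bracket X A)) derived_ideal_mx_bracket //.
have [_ -> //] := lie_prodP (hyperplane X) (hyperplane X)
  (lie_bilinear (mx_bracket_lie A)).
by move=> u v uH vH; rewrite mx_bracket_commutative ?mem0v.
Qed.

(** * Ranks of the coadjoint forms, that is, dimensions of the K-orbits *)

Lemma coadjoint_form_bilinear A (F : 'Hom(V, R^o)) :
  is_bilinear (coadjoint_form (mx_bracket X A) F).
Proof.
have [linr linl] := lie_bilinear (mx_bracket_lie A).
by split=> [w a u v|w a u v]; rewrite /coadjoint_form ?linr ?linl linearP.
Qed.

Lemma coadjoint_formE A (F : 'Hom(V, R^o)) u v :
  coadjoint_form (mx_bracket X A) F u v =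
    last_coord u * F (of_hyper (A *m hyper_coord v)) -
    last_coord v * F (of_hyper (A *m hyper_coord u)).
Proof.
by rewrite /coadjoint_form mx_bracketE mulmxBr -!scalemxAr !linearB !linearZ.
Qed.

(** Every covector B_F(u, -) is a combination of two fixed ones: [P], which is F o A on the
    hyperplane part, and [T], the last coordinate. *)
Lemma coadjoint_rank_le2 A (F : 'Hom(V, R^o)) :
  (form_rank (coadjoint_form (mx_bracket X A) F) <= 2)%N.
Proof.
pose P := linfun (F \o (of_hyper \o (mulmx A \o hyper_coord))).
pose L : {linear V -> R^o} := HB.pack (last_coord : V -> R^o)
  (GRing.isLinear.Build R V R^o _ _ last_coord_is_linear).
pose T : 'Hom(V, R^o) := linfun L.
have TE v : T v = last_coord v by apply: (lfunE L).
apply: leq_trans (dim_span [:: P; T]); apply/dimvS/subvP => _ /memv_imgP[u _ ->].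
have -> : form_map (coadjoint_form (mx_bracket X A) F) u =
    last_coord u *: P - F (of_hyper (A *m hyper_coord u)) *: T.
  apply/lfunP => v; rewrite form_mapE; last exact: coadjoint_form_bilinear.
  rewrite coadjoint_formE !lfunE /= !lfunE /= !lfunE /= TE.
  by congr (_ - _); apply: mulrC.
by apply: memvB; apply/memvZ/memv_span; rewrite !inE eqxx ?orbT.
Qed.

Lemma coadjoint_rank_eq0 A (F : 'Hom(V, R^o)) :
  (forall x, F (of_hyper (A *m x)) = 0) ->
  form_rank (coadjoint_form (mx_bracket X A) F) = 0%N.
Proof.
move=> F0; apply/eqP; rewrite dimv_eq0 -subv0; apply/subvP => _ /memv_imgP[u _ ->].
rewrite memv0; apply/eqP/lfunP => v.
rewrite form_mapE; last exact: coadjoint_form_bilinear.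
by rewrite coadjoint_formE !F0 !mulr0 subrr lfunE.
Qed.

Lemma coadjoint_rank_ge2 A (F : 'Hom(V, R^o)) x :
  F (of_hyper (A *m x)) != 0 ->
  (2 <= form_rank (coadjoint_form (mx_bracket X A) F))%N.
Proof.
move=> Fx; pose M := form_map (coadjoint_form (mx_bracket X A) F).
have ME u v : M u v = coadjoint_form (mx_bracket X A) F u v.
  by rewrite form_mapE //; exact: coadjoint_form_bilinear.
have freeM : free [:: M X`_m; M (of_hyper x)].
  (* At [of_hyper x] the first covector takes a non-zero value and the second vanishes, so the first
     is no multiple of the second. The second is non-zero, as its value at the last basis vector
     shows. *)
  rewrite free_cons seq1_free span_seq1; apply/andP; split.
    apply/vlineP => -[k /lfunP/(_ (of_hyper x))]; rewrite lfunE /= !ME.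
    rewrite !coadjoint_formE !last_coord_of_hyper last_coord_last of_hyperK.
    by rewrite !mul0r mul1r !subr0 scaler0 => /eqP; rewrite (negPf Fx).
  apply: contra_neq Fx => /lfunP/(_ X`_m); rewrite ME coadjoint_formE.
  rewrite lfunE last_coord_of_hyper last_coord_last of_hyperK mul0r mul1r.
  by rewrite sub0r => /eqP; rewrite oppr_eq0 => /eqP.
rewrite -[2%N]/(size [:: M X`_m; M (of_hyper x)]) -(eqnP freeM).
apply/dimvS/span_subvP => w; rewrite !inE => /orP[] /eqP ->;
  exact: memv_img (memvf _).
Qed.

(** The rank is 0 when F o A = 0; otherwise it is at least 2, a bound that no other form exceeds. *)
Lemma mx_bracket_MD A : A \in unitmx -> is_MD_algebra (mx_bracket X A).
Proof.
move=> uA; split; [exact: mx_bracket_lie|exact: mx_bracket_solvable|move=> F].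
pose P := linfun (F \o (of_hyper \o mulmx A)).
have PE x : P x = F (of_hyper (A *m x)) by rewrite lfunE.
have [P0|P_neq0] := eqVneq P 0.
  by left; apply: coadjoint_rank_eq0 => x; rewrite -PE P0 lfunE.
right=> F'; apply: leq_trans (coadjoint_rank_le2 A F') _.
have /subvPn[x _] : ~~ (fullv <= lker P)%VS.
  apply: contra P_neq0 => /subvP kP; apply/eqP/lfunP => x; rewrite zero_lfunE.
  by have := kP x (memvf x); rewrite memv_ker => /eqP.
rewrite memv_ker => Px; apply: (@coadjoint_rank_ge2 _ _ x); rewrite -PE //.
Qed.

Lemma mx_bracket_matrix A :
  is_matrix_of (mx_bracket X A X`_m) (hyperplane X) (hyper_basis X) A.
Proof.
split.
- by rewrite basisEdim subvv dim_hyperplane size_tuple leqnn.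
- by move=> u _; rewrite mem_hyperplane last_coord_mx_bracket.
apply/matrixP => i j; rewrite mxE nth_mktuple -of_hyper_delta mx_bracket_last.
rewrite -colE /of_hyper linear_sum (bigD1 i) //= big1 ?addr0 => [|k ki].
  rewrite linearZ /= -[X`_i](nth_mktuple (fun i => X`_i) 0 i).
  by rewrite (coord_free i _ hyper_basis_free) eqxx mulr1 mxE.
rewrite linearZ /= -[X`_k](nth_mktuple (fun i => X`_i) 0 k).
by rewrite (coord_free k _ hyper_basis_free) (negPf ki) mulr0.
Qed.

(** * Isomorphisms and conjugacy up to scaling *)

Lemma lie_isomorphic_conj (A B P : 'M[R]_m) c : P \in unitmx -> c != 0 ->
  P *m A = c *: (B *m P) ->
  lie_isomorphic (mx_bracket X A) (mx_bracket X B).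
Proof.
move=> uP c0 PA.
(* The matrix and the scalar are left free so that the inverse map has the same form, with [invmx P]
   and [c^-1]. *)
pose h (Q : 'M[R]_m) a u :=
  of_hyper (Q *m hyper_coord u) + (a * last_coord u) *: X`_m.
have hyperh Q a u : hyper_coord (h Q a u) = Q *m hyper_coord u.
  by rewrite linearD linearZ /= of_hyperK hyper_coord_last scaler0 addr0.
have lasth Q a u : last_coord (h Q a u) = a * last_coord u.
  by rewrite linearD linearZ /= last_coord_of_hyper last_coord_last add0r mulr1.
have linh Q a : linear (h Q a).
  move=> k u v; rewrite /h !linearP /= scalerDr scalerA addrACA -scalerDl.
  by congr (_ + _ *: _); ring.
pose L : {linear V -> V} :=
  HB.pack (h P c) (GRing.isLinear.Build _ _ _ _ _ (linh P c)).
exists (linfun L); split.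
  exists (h (invmx P) c^-1) => u; rewrite lfunE /= [RHS]hyper_decomp /h.
    by rewrite hyperh lasth mulKmx // mulKf.
  by rewrite hyperh lasth mulKVmx // mulVKf.
move=> u v; rewrite !lfunE /= /h last_coord_mx_bracket mulr0 scale0r addr0.
rewrite !mx_bracketE of_hyperK !hyperh !lasth -!scalerA -scalerBr !scalemxAr.
by rewrite -mulmxBr -!scalemxAr !mulmxA PA -scalemxAl.
Qed.

Lemma lie_isomorphic_conj_inv (A B : 'M[R]_m) :
  A \in unitmx -> lie_isomorphic (mx_bracket X A) (mx_bracket X B) ->
  exists (c : R) (P : 'M[R]_m),
    [/\ c != 0, P \in unitmx & P *m A = c *: (B *m P)].
Proof.
move=> uA [f [bijf fM]].
(* Since A is invertible, each hyperplane vector is a bracket; [f] sends it to a bracket, hence into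
   the hyperplane. *)
have last_f x : last_coord (f (of_hyper x)) = 0.
  by rewrite -(mulKVmx uA x) -mx_bracket_last fM last_coord_mx_bracket.
pose P : 'M[R]_m := \matrix_(i, j) hyper_coord (f X`_j) i 0.
have fE x : f (of_hyper x) = of_hyper (P *m x).
  rewrite -[LHS](hyper_coordK _ (last_f x)); congr of_hyper.
  rewrite /of_hyper !linear_sum; apply/colP => i; rewrite summxE mxE.
  by apply: eq_bigr => j _; rewrite !linearZ !mxE mulrC.
pose c := last_coord (f X`_m); exists c, P; split.
(* If c = 0, the whole image of [f] lies in the hyperplane, contradicting that [f] reaches the last
   basis vector. *)
- apply: contraTneq (oner_neq0 R) => c0; have [g _ gK] := bijf.
  rewrite negbK -last_coord_last -(gK X`_m) (hyper_decomp (g _)).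
  by rewrite linearD linearZ linearD linearZ /= last_f -/c c0 mulr0 addr0.
(* A kernel vector of P would be killed by the injective [f]. The transpose appears because [det0P]
   speaks of row vectors. *)
- rewrite -unitmx_tr unitmxE unitfE; apply/det0P => -[v v0 vP].
  case/eqP: v0; apply: trmx_inj; rewrite trmx0.
  apply: (can_inj of_hyperK); apply: (bij_inj bijf).
  by rewrite linear0 linear0 fE -[P]trmxK -trmx_mul vP trmx0 linear0.
have mx_eq (Q Q' : 'M[R]_m) : (forall x : 'cV_m, Q *m x = Q' *m x) -> Q = Q'.
  by move=> QQ'; apply/matrixP=> i j; have /colP/(_ i) := QQ' (delta_mx j 0);
    rewrite -!colE !mxE.
(* Apply [f] to the bracket of the last basis vector with [of_hyper x]. The hyperplane part of the
   image of the last basis vector is unknown, but it is multiplied by the last coordinate of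
   [f (of_hyper x)], which is 0. *)
apply: mx_eq => x; apply: (can_inj of_hyperK).
rewrite -mulmxA -fE -mx_bracket_last fM fE mx_bracketE last_coord_of_hyper.
by rewrite of_hyperK scale0r subr0 -/c -scalemxAr mulmxA scalemxAl.
Qed.

End HyperplaneCoordinates.

Theorem theorem4p5 (R : realType) (n : nat) (hn : (3 <= n)%N)
    (G : vectType R) (X : n.-tuple G) (hX : basis_of fullv X) :
  (forall A : 'M[R]_n.-1, A \in unitmx ->
     [/\ is_lie_bracket (mx_bracket X A),
         is_MD_algebra_nm (mx_bracket X A) n n.-1,
         commutative_on (mx_bracket X A) (derived_ideal (mx_bracket X A)),
         derived_ideal (mx_bracket X A) = hyperplane X &
         is_matrix_of (mx_bracket X A X`_n.-1) (hyperplane X) (hyper_basis X) A])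
  /\
  (forall A B : 'M[R]_n.-1, A \in unitmx -> B \in unitmx ->
     (lie_isomorphic (mx_bracket X A) (mx_bracket X B) <->
      exists (c : R) (C : 'M[R]_n.-1),
        [/\ c != 0, C \in unitmx & c *: A = C *m B *m invmx C])).
Proof.
(* With n = m + 1, [n.-1] computes to [m] and the coordinate lemmas apply. *)
case: n hn X hX => // m m_ge2 X hX; split=> [A uA|A B uA uB].
  split.
  - exact: mx_bracket_lie.
  - split.
    + by rewrite ltnSn andbT; exact: ltnW m_ge2.
    + exact: mx_bracket_MD.
    + by rewrite -(size_basis hX).
    + by rewrite derived_ideal_mx_bracket // dim_hyperplane.
  - by rewrite derived_ideal_mx_bracket //; apply: mx_bracket_commutative.
  - exact: derived_ideal_mx_bracket.
  - exact: mx_bracket_matrix.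
split=> [/(lie_isomorphic_conj_inv _ hX _ _ uA)|] [c [C [c0 uC eqAB]]].
  (* Here [C] stands for P in P A = c B P, which rearranges to c^-1 A = P^-1 B P; the converse below
     inverts both data again. *)
  exists c^-1, (invmx C); split; rewrite ?invr_eq0 ?unitmx_inv // invmxK.
  by rewrite -(mulKmx uC A) eqAB -scalemxAr scalerA mulVf // scale1r mulmxA.
apply: (@lie_isomorphic_conj _ _ _ X hX _ _ (invmx C) c^-1).
- by rewrite unitmx_inv.
- by rewrite invr_eq0.
- rewrite -[A in LHS](scalerK c0) eqAB -scalemxAr; congr (_ *: _).
  by rewrite -mulmxA mulKmx.
Qed.
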